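(* For all positive integers $k$ and $d$, there are only finitely many equivalence classes $[T(G,\bar g)]_{\equiv_{\mathsf{CTL}^*_d\setminus\mathsf{X}}}$, where $G$ ranges over all topologies and $\bar g$ over all $k$-tuples of distinct vertices of $G$.
   Context: A topology is a directed graph $G=(V,E,x)$ with $V=[n]$ for some $n\ge1$, initial vertex $x\in V$, and $E\subseteq V\times V$ without self-loops. For a $k$-tuple $\bar g=(g_1,\dots,g_k)$ of distinct vertices, the graph LTS $T(G,\bar g)$ is the labeled transition system with state set $V$, initial state $x$, a single action $a$, a transition $(v,a,w)$ iff $(v,w)\in E$, and labeling $\Lambda(v)=\{i\}$ if $v=g_i$ and $\Lambda(v)=\emptyset$ otherwise (atoms $1,\dots,k$). $\mathsf{CTL}^*_d\setminus\mathsf{X}$ is the fragment of $\mathsf{CTL}^*$ without the next-time operator with path-quantifier nesting depth at most $d$; $M\equiv_{\mathsf{CTL}^*_d\setminus\mathsf{X}}N$ iff $M$ and $N$ satisfy exactly the same $\mathsf{CTL}^*_d\setminus\mathsf{X}$ formulas. *)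

(* Defs.v *)
From mathcomp Require Import all_boot.
From mathcomp Require Import boolp classical_sets cardinality.

Set Implicit Arguments.
Unset Strict Implicit.
Unset Printing Implicit Defensive.

Local Open Scope classical_set_scope.

Record lts (AP : Type) := Lts {
  state : Type;
  action : Type;
  init : state;
  trans : state -> action -> state -> Prop;
  label : state -> set AP
}.

(* The remaining connectives and operators are the usual abbreviations, none of
   which changes the depth below: A f = ~ E ~ f, F f = true U f, G f = ~ F ~ f. *)
Inductive state_formula (AP : Type) : Type :=
| STrue
| SAtom of AP
| SNot of state_formula AP
| SAnd of state_formula AP & state_formula AP
| SExists of path_formula AP
with path_formula (AP : Type) : Type :=
| PState of state_formula AP
| PNot of path_formula AP
| PAnd of path_formula AP & path_formula AP
| PNext of path_formula AP
| PUntil of path_formula AP & path_formula AP.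

Arguments STrue {AP}.

Fixpoint next_free AP (f : state_formula AP) : bool :=
  match f with
  | STrue | SAtom _ => true
  | SNot f => next_free f
  | SAnd f g => next_free f && next_free g
  | SExists h => pnext_free h
  end
with pnext_free AP (h : path_formula AP) : bool :=
  match h with
  | PState f => next_free f
  | PNot h => pnext_free h
  | PAnd h1 h2 | PUntil h1 h2 => pnext_free h1 && pnext_free h2
  | PNext _ => false
  end.

Fixpoint depth AP (f : state_formula AP) : nat :=
  match f with
  | STrue | SAtom _ => 0
  | SNot f => depth f
  | SAnd f g => maxn (depth f) (depth g)
  | SExists h => (pdepth h).+1
  end
with pdepth AP (h : path_formula AP) : nat :=
  match h with
  | PState f => depth f
  | PNot h | PNext h => pdepth h
  | PAnd h1 h2 | PUntil h1 h2 => maxn (pdepth h1) (pdepth h2)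
  end.

Definition step AP (M : lts AP) (s t : state M) : Prop :=
  exists a : action M, trans s a t.

(* Finite and infinite paths are both encoded as p : nat -> option (state M),
   where p i = None means that the path has at most i states.  Transition
   relations need not be total, so path quantifiers range over maximal paths:
   the infinite ones and the finite ones ending in a state without successor. *)
Definition maximal_path AP (M : lts AP) (s : state M)
    (p : nat -> option (state M)) : Prop :=
  p 0 = Some s /\
  forall i : nat,
    match p i, p i.+1 with
    | Some u, Some v => step u v
    | Some u, None => forall v, ~ step u v
    | None, q => q = None
    end.

Section Semantics.
Variables (AP : Type) (M : lts AP).

(* psat h p i: the suffix of p starting at position i satisfies h; only
   meaningful when p i is not None. *)
Fixpoint sat (f : state_formula AP) (s : state M) : Prop :=
  match f with
  | STrue => True
  | SAtom a => label s a
  | SNot f => ~ sat f s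
  | SAnd f g => sat f s /\ sat g s
  | SExists h => exists2 p, maximal_path s p & psat h p 0
  end
with psat (h : path_formula AP) (p : nat -> option (state M)) (i : nat) : Prop :=
  match h with
  | PState f => exists2 s, p i = Some s & sat f s
  | PNot h => ~ psat h p i
  | PAnd h1 h2 => psat h1 p i /\ psat h2 p i
  | PNext h => p i.+1 /\ psat h p i.+1
  | PUntil h1 h2 =>
      exists j : nat, [/\ i <= j, p j, psat h2 p j
        & forall l : nat, i <= l < j -> psat h1 p l]
  end.

End Semantics.

Definition models AP (M : lts AP) (f : state_formula AP) : Prop :=
  sat f (init M).

Definition ctlsx_equiv AP (d : nat) (M N : lts AP) : Prop :=
  forall f : state_formula AP, next_free f -> depth f <= d ->
    (models M f <-> models N f).

(* 'I_n is {0, ..., n-1}; the initial vertex forces n >= 1. *)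
Record topology (n : nat) := Topology {
  edge : rel 'I_n;
  edge_irrefl : irreflexive edge;
  root_vertex : 'I_n
}.

(* Atom i : 'I_k stands for the (i+1)-st atom.  When the entries of g are
   distinct, the label of v is {i} if v = g_i, and empty if v is not in g. *)
Definition graph_lts (n k : nat) (G : topology n) (g : k.-tuple 'I_n) :
    lts 'I_k :=
  {| state := 'I_n;
     action := unit;
     init := root_vertex G;
     trans := fun v _ w => edge G v w;
     label := fun v => [set i | v = tnth g i] |}.

Record marked_topology (k : nat) := MarkedTopology {
  num_vertices : nat;
  graph : topology num_vertices;
  marks : k.-tuple 'I_num_vertices;
  marks_uniq : uniq marks
}.

Definition marked_lts (k : nat) (m : marked_topology k) : lts 'I_k :=
  graph_lts (graph m) (marks m).

(* The class of T(G, g), as a set of pairs (G', g') rather than of systems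
   T(G', g'): sets of elements of the large type lts raise universe issues. *)
Definition ctlsx_class (k d : nat) (m : marked_topology k) :
    set (marked_topology k) :=
  [set m' | ctlsx_equiv d (marked_lts m) (marked_lts m')].

(* Main.v *)
(** Colour the vertices by finitely many colours, uniformly over all topologies,
    so that equal colours (together with equal colours at the marks) imply
    agreement on formulas of depth at most d.  For d = 0 the colour is the set
    of marks at the vertex.  To go from d to d+1, add to the colour of v the
    collection of the sets of d-colours seen on runs from v up to and including
    the first marked vertex met after leaving v (or forever).  Along an edge
    between unmarked vertices the rank of the colour drops whenever the colour
    changes, so a set of colours determines the order in which they are seen,
    that is, the segment up to stuttering.  Since a mark occurs at a single
    vertex, the segments of a path can be matched one after the other in another
    topology, which matches the whole path up to stuttering.  *)

Require Import Defs.
From mathcomp Require Import all_boot.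
From mathcomp Require Import boolp classical_sets cardinality.

Set Implicit Arguments.
Unset Strict Implicit.
Unset Printing Implicit Defensive.

(** * Stuttering and formulas without the next-time operator *)

Definition sat_equiv AP (d : nat) (M N : lts AP) (u : state M) (v : state N) :
    Prop :=
  forall f : state_formula AP, next_free f -> depth f <= d ->
    (sat f u <-> sat f v).

Definition prefix_closed (S : Type) (p : nat -> option S) : Prop :=
  forall i, p i.+1 -> p i.

(** The answer may be empty ([j' = j]) or long, so either path may stutter. A two-sided
    correspondence is this condition for [R] together with the one for its converse. *)
Definition stutter_simulation (S : Type) (p : nat -> option S)
    (R : nat -> nat -> Prop) : Prop :=
  forall i j, R i j -> p i.+1 ->
    exists j', [/\ j <= j', R i.+1 j' & forall l, j <= l < j' -> R i l].

(** The answers to single steps are concatenated. Positions passed on the way stay related to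
    positions strictly below [i + n], which is what the left argument of an until needs. *)
Lemma stutter_simulation_reach (S : Type) (p : nat -> option S) R i j n :
  prefix_closed p -> stutter_simulation p R -> R i j -> p (i + n) ->
  exists j', [/\ j <= j', R (i + n) j'
    & forall l', j <= l' < j' -> exists2 l, i <= l < i + n & R l l'].
Proof.
move=> pc sim Rij; elim: n => [|n IHn].
  rewrite addn0 => _; exists j; split=> // l' /andP[le_jl /leq_trans/(_ le_jl)].
  by rewrite ltnn.
rewrite addnS => pn; have [j1 [le_j1 R1 H1]] := IHn (pc _ pn).
have [j2 [le_j2 R2 H2]] := sim _ _ R1 pn.
exists j2; split=> //; first exact: leq_trans le_j2.
move=> l' /andP[le_l lt_l]; case: (ltnP l' j1) => lt_l1.
  have [|l /andP[a b] Rl] := H1 l'; first by rewrite le_l.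
  by exists l => //; rewrite a ltnS ltnW.
exists (i + n); first by rewrite leq_addr ltnS leqnn.
by apply: H2; rewrite lt_l1.
Qed.

(** Abstract predicates let this one direction of the until case serve twice, for [R] and for its
    converse. *)
Lemma until_stutter AP (M N : lts AP) (p : nat -> option (state M))
    (q : nat -> option (state N)) R (P1 P2 : nat -> Prop) (Q1 Q2 : nat -> Prop) :
  prefix_closed p -> stutter_simulation p R ->
  (forall i j, R i j -> q j) ->
  (forall i j, R i j -> P1 i -> Q1 j) -> (forall i j, R i j -> P2 i -> Q2 j) ->
  forall i j, R i j ->
  (exists i', [/\ i <= i', p i', P2 i' & forall l, i <= l < i' -> P1 l]) ->
  exists j', [/\ j <= j', q j', Q2 j' & forall l, j <= l < j' -> Q1 l].
Proof.
move=> pc sim Rq PQ1 PQ2 i j Rij [i' [le_i pi' P2i' P1l]].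
rewrite -(subnKC le_i) in pi'.
have [j' [le_j Rj' H]] := stutter_simulation_reach pc sim Rij pi'.
rewrite subnKC // in Rj' H; exists j'; split=> //.
- exact: Rq Rj'.
- exact: PQ2 Rj' P2i'.
- by move=> l' /H[l lt_l Rl]; apply: PQ1 Rl _; apply: P1l.
Qed.

(** State subformulas act as atoms, settled by [sat_equiv d]; with next-time excluded, only until
    looks along the path. *)
Lemma psat_stutter AP (d : nat) (M N : lts AP) (p : nat -> option (state M))
    (q : nat -> option (state N)) (R : nat -> nat -> Prop) :
  prefix_closed p -> prefix_closed q ->
  stutter_simulation p R ->
  stutter_simulation q (fun j i => R i j) ->
  (forall i j, R i j -> exists u v,
     [/\ p i = Some u, q j = Some v & sat_equiv d u v]) ->
  forall h, pnext_free h -> pdepth h <= d ->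
  forall i j, R i j -> (psat h p i <-> psat h q j).
Proof.
move=> pc qc simp simq RE.
have Rp i j : R i j -> p i by case/RE=> u [v [-> _ _]].
have Rq i j : R i j -> q j by case/RE=> u [v [_ -> _]].
elim=> [f|h IH|h1 IH1 h2 IH2|h IH|h1 IH1 h2 IH2] //=.
- move=> nf df i j /RE[u [v [-> -> E]]].
  split=> [[_ [<-]]|[_ [<-]]] /(E f nf df) Hf; first by exists v.
  by exists u.
- by move=> nf df i j /(IH nf df) E; split=> H1 /E.
- move=> /andP[nf1 nf2]; rewrite geq_max => /andP[df1 df2] i j Rij.
  by rewrite (IH1 nf1 df1 _ _ Rij) (IH2 nf2 df2 _ _ Rij).
- move=> /andP[nf1 nf2]; rewrite geq_max => /andP[df1 df2] i j Rij.
  have {}IH1 := IH1 nf1 df1; have {}IH2 := IH2 nf2 df2.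
  split.
    by apply: (until_stutter pc simp Rq) Rij => a b /[dup] /IH1 E1 /IH2 E2; tauto.
  apply: (until_stutter (R := fun j i => R i j) qc simq _ _ _) Rij => a b.
  + exact: Rp.
  + by move/IH1=> E; tauto.
  + by move/IH2=> E; tauto.
Qed.

Lemma maximal_path_prefix_closed AP (M : lts AP) (s : state M) p :
  maximal_path s p -> prefix_closed p.
Proof. by move=> [_ pP] i; have := pP i; case: (p i) => // ->. Qed.

(** * Marked topologies, runs and colourings *)

Section MarkedTopology.
Context (k : nat).
Implicit Types m : marked_topology k.

Definition vertex m := 'I_(num_vertices m).

Definition arc m (u v : vertex m) : bool := edge (graph m) u v.

Definition dead m (v : vertex m) : bool := [forall w, ~~ arc v w].

Definition mark_set m (v : vertex m) : {set 'I_k} :=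
  finset (fun i => v == tnth (marks m) i).

Definition unmarked m (v : vertex m) : bool := mark_set v == finset.set0.

(** A dead vertex is repeated forever, so that finite maximal paths become total sequences too;
    without next-time the repetition is invisible. *)
Definition run m (r : nat -> vertex m) : Prop :=
  forall i, arc (r i) (r i.+1) \/ dead (r i) /\ r i.+1 = r i.

Definition shift (T : Type) (r : nat -> T) : nat -> T := fun i => r i.+1.

Definition prepend (T : Type) (u : T) (r : nat -> T) (i : nat) : T :=
  if i is j.+1 then r j else u.

Lemma arc_neq m (u v : vertex m) : arc u v -> u != v.
Proof. by move=> uv; apply: contraTneq uv => ->; rewrite /arc edge_irrefl. Qed.

(** The colour type does not depend on the topology, which is the source of uniform finiteness.
    [rankP] keeps a run from returning to a colour it has left before it meets a mark. *)
Record coloring := Coloring {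
  color_type :> finType;
  color : forall m, vertex m -> color_type;
  color_marks : color_type -> {set 'I_k};
  rank : color_type -> nat;
  color_marksP : forall m (v : vertex m), color_marks (color v) = mark_set v;
  rankP : forall m (u v : vertex m), unmarked u -> unmarked v -> arc u v ->
    color u = color v \/ rank (color v) < rank (color u)
}.

Arguments color _ {m} _ : rename.

(** * Traces and segments of runs *)

Section Coloring.
Context (C : coloring).

Lemma color_unmarked m m' (u : vertex m) (v : vertex m') :
  color C u = color C v -> unmarked u = unmarked v.
Proof. by rewrite /unmarked -!(color_marksP C) => ->. Qed.

(** The strict bound [i < l] lets the first marked vertex contribute its colour. *)
Definition trace m (r : nat -> vertex m) : {set C} :=
  finset (fun c => `[< exists2 l, (forall i, i < l -> unmarked (r i))
                                & color C (r l) = c >]).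

(* For an unmarked start the trace begins at the start itself, so that prepending
   an unmarked vertex of the same colour leaves the segment unchanged. *)
Definition segment m (r : nat -> vertex m) : {set C} :=
  if unmarked (r 0) then trace r else trace (shift r).

Lemma trace0 m (r : nat -> vertex m) : color C (r 0) \in trace r.
Proof. by rewrite finset.in_set; apply/asboolP; exists 0. Qed.

Lemma trace_marked m (r : nat -> vertex m) :
  ~~ unmarked (r 0) -> trace r = [set color C (r 0)]%SET.
Proof.
move=> r0; apply/setP=> c; rewrite finset.in_set finset.in_set1.
apply/asboolP/eqP => [[[|l] lu <-//]|->]; last by exists 0.
by move: r0; rewrite lu.
Qed.

Lemma trace_unmarked m (r : nat -> vertex m) :
  unmarked (r 0) -> trace r = (color C (r 0) |: trace (shift r))%SET.
Proof.
move=> r0; apply/setP=> c; rewrite finset.in_set finset.in_setU1 finset.in_set.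
apply/asboolP/orP => [[[|l] lu <-]|[/eqP->|/asboolP[l lu <-]]].
- by left.
- by right; apply/asboolP; exists l => // i lt_i; apply: lu.
- by exists 0.
- by exists l.+1 => // -[|i] // /lu.
Qed.

Lemma trace_quiet m (r : nat -> vertex m) :
  unmarked (r 0) -> color C (r 1) = color C (r 0) -> trace (shift r) = trace r.
Proof.
move=> r0 E; rewrite (trace_unmarked r0); apply/esym/finset.setUidPr.
by rewrite finset.sub1set -E; apply: trace0.
Qed.

(** A colour without marks comes from a position up to which all vertices are unmarked; until there
    the rank drops at every change of colour. *)
Lemma rank_trace m (r : nat -> vertex m) c :
  run r -> c \in trace r -> color_marks c = finset.set0 ->
  c = color C (r 0) \/ rank c < rank (color C (r 0)).
Proof.
move=> rr; rewrite finset.in_set => /asboolP[l lu <-] cl.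
have {cl lu} : forall i, i <= l -> unmarked (r i).
  move=> i; rewrite leq_eqVlt => /orP[/eqP->|/lu//].
  by rewrite /unmarked -(color_marksP C) cl.
elim: l => [|l IHl] lu; first by left.
have {IHl} IH : color C (r l) = color C (r 0) \/
    rank (color C (r l)) < rank (color C (r 0)).
  by apply: IHl => i le_i; apply/lu/leqW.
have [a|[_ ->]//] := rr l.
have [<-//|lt] := rankP C (lu l (leqnSn l)) (lu l.+1 (leqnn _)) a.
by case: IH => [<-|lt2]; right => //; apply: ltn_trans lt lt2.
Qed.

(* Both first colours have maximal rank among the unmarked ones of the trace. *)
Lemma trace_head m m' (r : nat -> vertex m) (s : nat -> vertex m') :
  run r -> run s -> trace r = trace s -> color C (r 0) = color C (s 0).
Proof.
move=> rr rs E.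
have [r0|r0] := boolP (unmarked (r 0)); last first.
  have := trace0 s; rewrite -E (trace_marked r0) finset.in_set1.
  by move/eqP.
have [s0|s0] := boolP (unmarked (s 0)); last first.
  by have := trace0 r; rewrite E (trace_marked s0) finset.in_set1 => /eqP.
have [||//|lt1] := @rank_trace _ s (color C (r 0)) rs.
- by rewrite -E trace0.
- by rewrite color_marksP; apply/eqP.
have [||//|lt2] := @rank_trace _ r (color C (s 0)) rr.
- by rewrite E trace0.
- by rewrite color_marksP; apply/eqP.
by have := ltn_trans lt1 lt2; rewrite ltnn.
Qed.

Lemma run_shift m (r : nat -> vertex m) : run r -> run (shift r).
Proof. by move=> rr i; apply: rr. Qed.

(** After the change either the rank is below that of the first colour, or the vertex is marked and
    the trace ends; in both cases the first colour cannot recur. *)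
Lemma trace_loud m (r : nat -> vertex m) :
  run r -> unmarked (r 0) -> color C (r 1) <> color C (r 0) ->
  trace (shift r) = (trace r :\ color C (r 0))%SET.
Proof.
move=> rr r0 ne; rewrite (trace_unmarked r0) finset.setU1K //.
apply/negP=> in0.
have c0 : color_marks (color C (r 0)) = finset.set0.
  by rewrite color_marksP; apply/eqP.
case: (rank_trace (run_shift rr) in0 c0) => [|lt1]; first exact/nesym.
have [a|[_ E]] := rr 0; last by apply: ne; rewrite E.
have [r1|r1] := boolP (unmarked (r 1)).
  have [//|lt2] := rankP C r0 r1 a; first by move/esym.
  by have := ltn_trans lt1 lt2; rewrite ltnn.
move: in0; rewrite (trace_marked (r := shift r) r1) finset.in_set1.
by move/eqP/esym.
Qed.

(** * Refinement of a colouring *)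

Definition segments m (v : vertex m) : {set {set C}} :=
  finset (fun X => `[< exists r, [/\ run r, r 0 = v & segment r = X] >]).

(** Putting [u] in front of a run from [v] adds no new colour and no mark, hence keeps its
    segment. *)
Lemma segments_sub m (u v : vertex m) :
  unmarked u -> unmarked v -> arc u v -> color C u = color C v ->
  segments v \subset segments u.
Proof.
move=> u0 v0 uv E; apply/fintype.subsetP=> X; rewrite !finset.in_set.
move=> /asboolP[r [rr rv <-]]; apply/asboolP; exists (prepend u r); split=> //.
  by case=> [|i] /=; [rewrite rv; left|apply: rr].
rewrite /segment /= u0 rv v0.
by rewrite -(trace_quiet (r := prepend u r)) //= rv E.
Qed.

Definition refined_color m (v : vertex m) : (C * {set {set C}})%type :=
  (color C v, segments v).

(** A lexicographic order coded as a number: the weight [#|{set C}|.+1] exceeds every [#|c.2|]. *)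
Definition refined_rank (c : C * {set {set C}}) : nat :=
  rank c.1 * #|{set C}|.+1 + #|c.2|.

Lemma refined_rankP m (u v : vertex m) :
  unmarked u -> unmarked v -> arc u v ->
  refined_color u = refined_color v \/
  refined_rank (refined_color v) < refined_rank (refined_color u).
Proof.
move=> u0 v0 uv; have [E|lt] := rankP C u0 v0 uv.
  have sub := segments_sub u0 v0 uv E.
  have [eS|neS] := eqVneq (segments u) (segments v).
    by left; rewrite /refined_color E eS.
  right; rewrite /refined_rank /= E ltn_add2l; apply: proper_card.
  by rewrite finset.properEneq eq_sym neS.
right; rewrite /refined_rank /=.
apply: (@leq_trans ((rank (color C v)).+1 * #|{set C}|.+1)).
  by rewrite mulSn addnC ltn_add2r ltnS max_card.
by apply: leq_trans (leq_addr _ _); rewrite leq_mul2r lt orbT.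
Qed.

End Coloring.

Definition refine (C : coloring) : coloring :=
  @Coloring (C * {set {set C}})%type (@refined_color C) (fun c => color_marks c.1)
    (@refined_rank C) (fun m v => color_marksP C v) (@refined_rankP C).

Lemma iter_shift (T : Type) (r : nat -> T) i l : iter i (@shift T) r l = r (i + l).
Proof. by elim: i l => [|i IHi] l //=; rewrite /shift IHi addnS. Qed.

(** * Matching a run in a second topology *)

Section Matching.
Context (C : coloring).

Definition matched m m' (r : nat -> vertex m) (s : nat -> vertex m') : Prop :=
  [/\ run r, run s, color C (r 0) = color C (s 0) & segment C r = segment C s].

Lemma matched_trace m m' (r : nat -> vertex m) (s : nat -> vertex m') :
  matched r s -> unmarked (r 0) -> trace C r = trace C s.
Proof.
by case=> _ _ E; rewrite /segment -(color_unmarked E) => Es r0; rewrite r0 in Es.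
Qed.

(** This excludes endless waiting: as [s 0] is unmarked, the colour of [s 1] lies in the common
    trace, where [r] leaves only one colour. *)
Lemma trace_constant m m' (r : nat -> vertex m) (s : nat -> vertex m') :
  unmarked (s 0) -> trace C r = trace C s ->
  (forall l, color C (r l) = color C (s 0)) -> color C (s 1) = color C (s 0).
Proof.
move=> s0 E cst.
have : color C (s 1) \in trace C s.
  by rewrite finset.in_set; apply/asboolP; exists 1 => // -[|].
by rewrite -E finset.in_set => /asboolP[l _ <-].
Qed.

Context (m m' : marked_topology k).
Context (marksE : forall i, color (refine C) (m := m) (tnth (marks m) i) =
                            color (refine C) (m := m') (tnth (marks m') i)).
Implicit Types (r : nat -> vertex m) (s : nat -> vertex m').

(** A mark occupies a single vertex, so a shared mark makes [u] and [v] corresponding entries of the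
    two tuples, where [marksE] applies. *)
Lemma marked_refine (u : vertex m) (v : vertex m') :
  ~~ unmarked u -> color C u = color C v ->
  color (refine C) u = color (refine C) v.
Proof.
move=> /finset.set0Pn[i iu] E.
have iv : i \in mark_set v by rewrite -(color_marksP C) -E color_marksP.
by move: iu iv; rewrite !finset.in_set => /eqP-> /eqP->.
Qed.

Lemma segments_matched (r : nat -> vertex m) (v : vertex m') :
  run r -> color (refine C) (r 0) = color (refine C) v ->
  exists2 s, s 0 = v & matched r s.
Proof.
move=> rr [E ES].
have : segment C r \in segments C (r 0).
  by rewrite finset.in_set; apply/asboolP; exists r.
rewrite ES finset.in_set => /asboolP[s [rs sv Es]].
by exists s => //; split=> //; rewrite sv.
Qed.

(** From an unmarked vertex [s] itself serves. At a marked one the trace ends, and equal refined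
    colours supply a new continuation. *)
Lemma trace_matched r s : run r -> run s -> trace C r = trace C s ->
  exists2 s', s' 0 = s 0 & matched r s'.
Proof.
move=> rr rs E; have E0 := trace_head rr rs E.
have [r0|r0] := boolP (unmarked (r 0)).
  by exists s => //; split=> //; rewrite /segment -(color_unmarked E0) r0.
by apply: segments_matched => //; apply: marked_refine.
Qed.

(* At a marked vertex [s] may be abandoned for another run [s'] from there, which
   is why only [s' 0] is prescribed. *)
Variant matched_step_spec r s : Prop :=
| MatchedBoth s' of s' 0 = s 1 & matched (shift r) s'
| MatchedLeft of unmarked (r 0) & color C (r 1) = color C (r 0)
    & color C (s 1) <> color C (s 0) & matched (shift r) s
| MatchedRight of unmarked (r 0) & color C (r 1) <> color C (r 0)
    & color C (s 1) = color C (s 0) & matched r (shift s).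

(** Both runs advance from a marked vertex, when both keep their colour, and when both change it,
    since then both traces lose the same first colour. If only one is about to change, it waits for
    the other. *)
Lemma matched_step r s : matched r s -> matched_step_spec r s.
Proof.
move=> rs; have [rr ss E0 Eseg] := rs.
have both : trace C (shift r) = trace C (shift s) -> matched_step_spec r s.
  move=> E; have [s' s'0 ms'] := trace_matched (run_shift rr) (run_shift ss) E.
  exact: MatchedBoth s'0 ms'.
have Eu := color_unmarked E0.
have [r0|r0] := boolP (unmarked (r 0)); last first.
  by apply: both; move: Eseg; rewrite /segment -Eu (negPf r0).
have s0 : unmarked (s 0) by rewrite -Eu.
have Et := matched_trace rs r0.
have [r1|r1] := eqVneq (color C (r 1)) (color C (r 0));
  have [s1|s1] := eqVneq (color C (s 1)) (color C (s 0)).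
- by apply: both; rewrite !trace_quiet.
- apply: MatchedLeft => //; first exact/eqP.
  split=> //; [exact: run_shift|by rewrite [LHS]r1|].
  by rewrite /segment [unmarked (shift r 0)](color_unmarked r1) r0 s0 trace_quiet.
- apply: MatchedRight => //; first exact/eqP.
  split=> //; [exact: run_shift|by rewrite [RHS]s1|].
  by rewrite /segment [unmarked (shift s 0)](color_unmarked s1) r0 s0 trace_quiet.
- apply: both.
  by rewrite (trace_loud rr r0 (elimN eqP r1)) (trace_loud ss s0 (elimN eqP s1)) Et E0.
Qed.

(** The second clause is a fairness condition: removing repetitions has to leave a maximal path. *)
Definition lazy_run (x : nat -> vertex m') : Prop :=
  (forall j, x j.+1 = x j \/ arc (x j) (x j.+1)) /\
  (forall j, (forall n, x (j + n) = x j) -> dead (x j)).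

(** A configuration is a position in [r] with the run still to be followed in [m']. The one-sided
    steps record colours so that endless waiting can be refuted. *)
Variant config_step r (c c' : nat * (nat -> vertex m')) : Prop :=
| StepBoth of c'.1 = c.1.+1 & c'.2 0 = c.2 1
| StepLeft of c' = (c.1.+1, c.2) & unmarked (r c.1)
    & color C (r c.1.+1) = color C (r c.1) & color C (c.2 1) <> color C (c.2 0)
| StepRight of c' = (c.1, shift c.2) & unmarked (r c.1)
    & color C (r c.1.+1) <> color C (r c.1) & color C (c.2 1) = color C (c.2 0).

Lemma config_run r s : matched r s ->
  exists c : nat -> nat * (nat -> vertex m'),
    [/\ c 0 = (0, s), (forall j, matched (iter (c j).1 (@shift _) r) (c j).2)
      & forall j, config_step r (c j) (c j.+1)].
Proof.
move=> rs.
pose P (c : nat * (nat -> vertex m')) := matched (iter c.1 (@shift _) r) c.2.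
(* The existential stands outside the premise [P c], so that [choice] gives a total function to
   iterate. *)
have step (c : nat * (nat -> vertex m')) :
    exists c', P c -> P c' /\ config_step r c c'.
  have [Pc|] := pselect (P c); last by move=> nPc; exists c => /nPc.
  have [s' s'0 ms'|r0 r1 s1 ms|r0 r1 s1 ms] := matched_step Pc.
  - by exists (c.1.+1, s') => _; split=> //; apply: StepBoth.
  - exists (c.1.+1, c.2) => _; split=> //.
    by move: r0 r1; rewrite !iter_shift addn0 addn1 => r0 r1; apply: StepLeft.
  - exists (c.1, shift c.2) => _; split=> //.
    by move: r0 r1; rewrite !iter_shift addn0 addn1 => r0 r1; apply: StepRight.
have [f fP] := choice step.
have Pj j : P (iter j f (0, s)).
  by elim: j => [|j IHj] //=; case: (fP _ IHj).
exists (fun j => iter j f (0, s)); split=> // j.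
by case: (fP _ (Pj j)).
Qed.

Lemma matched_run r s : matched r s ->
  exists (phi : nat -> nat) (x : nat -> vertex m'),
  [/\ phi 0 = 0, x 0 = s 0,
      forall j, color C (r (phi j)) = color C (x j),
      forall j, phi j.+1 = phi j \/ phi j.+1 = (phi j).+1 &
      (forall j, exists n, phi (j + n) <> phi j) /\ lazy_run x].
Proof.
move=> /config_run[c [c0 cm cs]].
exists (fun j => (c j).1), (fun j => (c j).2 0); rewrite c0; split=> //.
- by move=> j; have [_ _ + _] := cm j; rewrite iter_shift addn0.
- by move=> j; case: (cs j) => [->|->|->]; auto.
split; last split.
(* If [phi] halted at [j], all later steps would be [StepRight]. The run in [m'] would then keep one
   colour, and by equality of traces so would the next vertex of [r], against [StepRight]. *)
- move=> j; apply: contrapT => /forallNP/(_ _)/contrapT H.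
  have right n : c (j + n).+1 = ((c (j + n)).1, shift (c (j + n)).2)
      /\ [/\ unmarked (r (c (j + n)).1),
             color C (r (c (j + n)).1.+1) <> color C (r (c (j + n)).1)
           & color C ((c (j + n)).2 1) = color C ((c (j + n)).2 0)].
    have := H n.+1; rewrite addnS -(H n).
    by case: (cs (j + n)) => [-> _|-> _ _ _|-> //] /eqP; rewrite eqn_leq ltnn.
  have cj n : c (j + n) = ((c j).1, iter n (@shift _) (c j).2).
    elim: n => [|n IHn]; first by rewrite addn0; case: (c j).
    by rewrite addnS; have [-> _] := right n; rewrite IHn.
  have cst n : color C ((c j).2 n) = color C ((c j).2 0).
    elim: n => // n <-; have [_ [_ _]] := right n.
    by rewrite cj /= !iter_shift addn0 addn1.
  have [_] := right 0; rewrite addn0 => -[r0 r1 _].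
  have r0' : unmarked (iter (c j).1 (@shift _) r 0) by rewrite iter_shift addn0.
  have [_ _ E0 _] := cm j.
  apply: r1; have := trace_constant r0' (esym (matched_trace (cm j) r0')).
  rewrite !iter_shift addn0 addn1; apply=> l.
  by rewrite cst -E0 iter_shift addn0.
- move=> j; have [_ rs _ _] := cm j.
  by case: (cs j) => [_ ->|-> *|-> *]; [|by left|];
    have [a|[_ E]] := rs 0; [right|left|right|left].
(* If [x] halted at a vertex that is not dead, the first step of the current run would always be an
   arc to another vertex, so all steps would be [StepLeft]. Then [r] keeps one colour, which
   contradicts the pending change of colour in [m']. *)
- move=> j H; apply: contrapT => /negP nd.
  have moves n : (c (j + n)).2 1 <> (c (j + n)).2 0.
    have [_ rs _ _] := cm (j + n).
    have [a|[]] := rs 0; first by apply/eqP; rewrite eq_sym arc_neq.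
    by rewrite H (negPf nd).
  have left n : c (j + n).+1 = ((c (j + n)).1.+1, (c (j + n)).2)
      /\ [/\ unmarked (r (c (j + n)).1),
             color C (r (c (j + n)).1.+1) = color C (r (c (j + n)).1)
           & color C ((c (j + n)).2 1) <> color C ((c (j + n)).2 0)].
    have := H n.+1; rewrite addnS -(H n).
    by case: (cs (j + n)) => [_ ->|-> //|-> _ _ _] /moves.
  have cj n : c (j + n) = ((c j).1 + n, (c j).2).
    elim: n => [|n IHn]; first by rewrite !addn0; case: (c j).
    by rewrite addnS; have [-> _] := left n; rewrite IHn addnS.
  have cst n : color C (r ((c j).1 + n)) = color C (r (c j).1).
    elim: n => [|n <-]; first by rewrite addn0.
    by rewrite addnS; have [_ []] := left n; rewrite cj.
  have [_] := left 0; rewrite addn0 => -[r0 _ s1].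
  have [_ _ E0 _] := cm j; rewrite iter_shift addn0 in E0.
  have r0' : unmarked (iter (c j).1 (@shift _) r 0) by rewrite iter_shift addn0.
  apply: s1; apply: trace_constant (matched_trace (cm j) r0') _.
    by rewrite -(color_unmarked E0).
  by move=> l; rewrite iter_shift cst.
Qed.

End Matching.

(** * Runs and maximal paths *)

Variant next_change (T : eqType) (x : nat -> T) (n : nat) : option nat -> Prop :=
| NextChange l of n <= l & (forall i, n <= i <= l -> x i = x n) & x l != x l.+1 :
    next_change x n (Some l.+1)
| NoChange of (forall i, x (n + i) = x n) : next_change x n None.

Lemma next_change_ex (T : eqType) (x : nat -> T) n : exists o, next_change x n o.
Proof.
have [ex|noex] := pselect (exists i, x (n + i) != x n); last first.
  exists None; apply: NoChange => i; apply/eqP; apply: contrapT => /negP ne.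
  by apply: noex; exists i.
case: (ex_minnP ex) => -[|i]; first by rewrite addn0 eqxx.
move=> ne min; have cst l : n <= l <= n + i -> x l = x n.
  move=> /andP[/subnKC <-]; rewrite leq_add2l => le_i.
  by apply/eqP; apply: contraLR le_i => /min; rewrite ltnNge.
exists (Some (n + i).+1); apply: NextChange => //; first exact: leq_addr.
by rewrite cst ?leq_addr ?leqnn // eq_sym -addnS.
Qed.

(** The path keeps one vertex of each maximal constant block; by fairness a block without end sits
    at a dead vertex. *)
Lemma lazy_run_path m (x : nat -> vertex m) : lazy_run x ->
  exists2 q, @maximal_path _ (marked_lts m) (x 0) q &
    forall h, pnext_free h ->
      (@psat _ (marked_lts m) h (fun i => Some (x i)) 0 <-> psat h q 0).
Proof.
move=> [xs fair]; have [f fP] := choice (next_change_ex x).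
(* The start of block [j]; [obind] keeps [None] once an endless block has been passed. *)
pose pos j := iter j (obind f) (Some 0).
pose q j : option (state (marked_lts m)) := omap x (pos j).
have qmax : @maximal_path _ (marked_lts m) (x 0) q.
  split=> // j; rewrite /q /=; case: (pos j) => [n|] //=.
  case: (fP n) => [l le_l cst ne|cst] /=.
    exists tt; rewrite /= -(cst l) ?le_l ?leqnn //.
    by case: (xs l) => // E; rewrite E eqxx in ne.
  move=> v [_ /= nv]; have /forallP/(_ v) := fair n cst.
  by rewrite /arc nv.
exists q => // h nf.
(* Position [i] lies in the block that starts at [pos j]. *)
pose R i j := exists n, [/\ pos j = Some n, n <= i
  & forall l, n <= l <= i -> x l = x n].
apply: (@psat_stutter _ (pdepth h) _ _ _ _ R) => //.
- exact: maximal_path_prefix_closed qmax.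
- move=> i j [n [En le_n cst]] _.
  have [E|ne] := eqVneq (x i) (x i.+1).
    exists j; split=> //; last by move=> l; rewrite ltnNge andbN.
    exists n; split=> //; first exact: leqW.
    move=> l /andP[le_l]; rewrite leq_eqVlt => /orP[/eqP->|lt_l]; last first.
      by apply: cst; rewrite le_l.
    by rewrite -E cst // le_n leqnn.
  exists j.+1; split=> //; last first.
    move=> l; rewrite ltnS -eqn_leq => /eqP <-.
    by exists n.
  exists i.+1; split=> //; last first.
    by move=> l; rewrite -eqn_leq => /eqP <-.
  rewrite /= En /=; case: (fP n) => [l le_l cst' ne'|cst'].
    case: (ltngtP l i) => [lt|lt|->//].
    + by rewrite !cst ?eqxx ?le_l ?leqW // ?(ltnW lt) in ne'.
    + by rewrite !cst' ?eqxx ?le_n ?leqW // ?(ltnW lt) in ne.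
  by rewrite -(subnKC le_n) -addnS !cst' eqxx in ne.
- move=> j i [n [En le_n cst]]; rewrite /q /= En /=.
  case Ef: _ / (fP n) => [l le_l cst' ne|] // _.
  have le_il : i <= l.
    rewrite leqNgt; apply/negP => lt.
    by rewrite !cst ?eqxx ?le_l ?leqW // ?(ltnW lt) in ne.
  exists l.+1; split; first exact: leqW.
    exists l.+1; split=> //=; last by move=> l'; rewrite -eqn_leq => /eqP <-.
    by rewrite En.
  move=> i' /andP[le_i']; rewrite ltnS => le_i'l; exists n; split=> //.
    exact: leq_trans le_i'.
  move=> l' /andP[a b]; apply: cst'; rewrite a.
  exact: leq_trans le_i'l.
- move=> i j [n [En le_n cst]]; exists (x i), (x i); split=> //.
  by rewrite /q En /= -(cst i) // le_n leqnn.
- by exists 0; split=> // l; rewrite leqn0 => /eqP ->.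
Qed.

Lemma path_run m (s : vertex m) p : @maximal_path _ (marked_lts m) s p ->
  exists r, [/\ run r, r 0 = s & forall h, pnext_free h ->
    (psat h p 0 <-> @psat _ (marked_lts m) h (fun i => Some (r i)) 0)].
Proof.
move=> pmax; have [p0 pP] := pmax.
(* The default repeats the last vertex once [p] has ended. *)
pose r := fix r i : vertex m := if i is i'.+1 then odflt (r i') (p i) else s.
have inv i : p i = Some (r i) \/ p i = None /\ dead (r i).
  elim: i => [|i [E|[E D]]]; first by left.
    have := pP i; rewrite E /=; case: (p i.+1) => [v|] nos; first by left.
    by right; split=> //; apply/forallP=> w; apply/negP=> a; apply: (nos w); exists tt.
  by have := pP i; rewrite E /= => ->; right.
have rr : run r.
  move=> i /=; case: (inv i) => [E|[E D]]; last first.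
    by right; split=> //; have := pP i; rewrite E /= => ->.
  have := pP i; rewrite E; case: (inv i.+1) => [E1|[E1 D]]; last first.
    by move: D; rewrite /= E1; right.
  by rewrite E1 => -[[] a]; left.
have stay i j : i <= j -> p i.+1 = None -> r j.+1 = r j.
  move=> le_ij E; rewrite /=; suff -> : p j.+1 = None by [].
  elim: j le_ij => [|j IHj]; first by rewrite leqn0 => /eqP <-.
  rewrite leq_eqVlt => /orP[/eqP <- //|]; rewrite ltnS => /IHj Ej.
  by have := pP j.+1; rewrite Ej.
exists r; split=> // h nf.
(* The last position of a finite [p] corresponds to itself and to all later positions of [r]. *)
pose R i j := p i = Some (r j) /\ (i = j \/ i <= j /\ p i.+1 = None).
apply: (@psat_stutter _ (pdepth h) _ _ _ _ R) => //.
- exact: maximal_path_prefix_closed pmax.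
- move=> i j [E [Eij|[_ ->//]]] pi; rewrite -{j}Eij in E *.
  exists i.+1; split=> //; last first.
    by move=> l; rewrite ltnS -eqn_leq => /eqP <-; split=> //; left.
  by split; [case: (inv i.+1) => // -[E1]; rewrite E1 in pi|left].
- move=> j i [E H] _.
  case Ep : (p i.+1) H => [v|] H.
    have Eij : i = j by case: H => // -[].
    rewrite -{j H}Eij in E *.
    exists i.+1; split=> //; last first.
      by move=> l; rewrite ltnS -eqn_leq => /eqP <-; split=> //; left.
    by split; [rewrite /= Ep|left].
  have le_ij : i <= j by case: H => [->|[]].
  exists i; split=> //; last by move=> l; rewrite ltnNge andbN.
  by split; [rewrite (stay _ _ le_ij Ep)|right; rewrite leqW].
- by move=> i j [E _]; exists (r j), (r j).
- by split=> //; left.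
Qed.

(** * Transfer of existential formulas and induction on the depth *)

Section Transfer.
Context (C : coloring) (d : nat) (m m' : marked_topology k).
Context (marksE : forall i, color (refine C) (m := m) (tnth (marks m) i) =
                            color (refine C) (m := m') (tnth (marks m') i)).
Context (satC : forall (u : vertex m) (v : vertex m'),
  color C u = color C v -> @sat_equiv _ d (marked_lts m) (marked_lts m') u v).

(** The witness passes from [p] to the run [r], to the lazy run [x] matched with it, and to the path
    [q], each time up to stuttering. *)
Lemma sat_exists_transfer (u : vertex m) (v : vertex m') h :
  color (refine C) u = color (refine C) v -> pnext_free h -> pdepth h <= d ->
  @sat _ (marked_lts m) (SExists h) u -> @sat _ (marked_lts m') (SExists h) v.
Proof.
move=> E nf dh [p pmax ph]; have [r [rr r0 rP]] := path_run pmax.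
rewrite -r0 in E; have [s s0 rs] := segments_matched rr E.
have [phi [x [phi0 x0 phix phiS [phiP xl]]]] := matched_run marksE rs.
have [q qmax qP] := lazy_run_path xl.
rewrite x0 s0 in qmax; exists q => //; apply/(qP _ nf); move/(rP _ nf): ph.
pose R i j := i = phi j.
have [] // : @psat _ (marked_lts m) h (fun i => Some (r i)) 0 <->
             @psat _ (marked_lts m') h (fun j => Some (x j)) 0.
apply: (@psat_stutter _ d (marked_lts m) (marked_lts m') _ _ R) => //.
(* As [phi] moves by at most one and never halts for good, its first new value after [j] is the
   successor of [phi j]. *)
- move=> _ j -> _; have ex : exists n, phi (j + n) != phi j.
    by have [n /eqP] := phiP j; exists n.
  case: (ex_minnP ex) => -[|n]; first by rewrite addn0 eqxx.
  move=> ne min.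
  have cst l : j <= l < j + n.+1 -> R (phi j) l.
    move=> /andP[/subnKC <-]; rewrite ltn_add2l => lt.
    by apply/esym/eqP; apply: contraLR lt => /min; rewrite -leqNgt.
  exists (j + n.+1); split=> //; first exact: leq_addr.
  have Ej : phi (j + n) = phi j by rewrite -cst // leq_addr addnS ltnS leqnn.
  move: ne; rewrite /R addnS -Ej.
  by case: (phiS (j + n)) => ->; rewrite ?eqxx.
- move=> j _ -> _; case: (phiS j) => E1; last first.
    exists (phi j).+1; split=> // l.
    by rewrite ltnS -eqn_leq => /eqP <-.
  by exists (phi j); split=> // l; rewrite ltnNge andbN.
- by move=> _ j ->; exists (r (phi j)), (x j); split=> //; apply: satC.
Qed.

End Transfer.

(** The marks are compared as well, because a refined colour describes runs only as far as the next
    mark. *)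
Definition decides (d : nat) (C : coloring) : Prop :=
  forall m m', (forall i, color C (m := m) (tnth (marks m) i) =
                          color C (m := m') (tnth (marks m') i)) ->
  forall (u : vertex m) (v : vertex m'), color C u = color C v ->
    @sat_equiv _ d (marked_lts m) (marked_lts m') u v.

Lemma sat_equiv_exists (C : coloring) d m m' (u : vertex m) (v : vertex m') :
  color C u = color C v ->
  (forall h, pnext_free h -> pdepth h < d ->
    (@sat _ (marked_lts m) (SExists h) u <->
     @sat _ (marked_lts m') (SExists h) v)) ->
  @sat_equiv _ d (marked_lts m) (marked_lts m') u v.
Proof.
move=> E HE; elim=> [|i|f IH|f1 IH1 f2 IH2|h] //=.
- move=> _ _; have : mark_set u = mark_set v by rewrite -!(color_marksP C) E.
  move/setP/(_ i); rewrite !finset.in_set => Ei.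
  by split=> /eqP; [rewrite Ei|rewrite -Ei] => /eqP.
- by move=> nf df; rewrite (IH nf df).
- move=> /andP[nf1 nf2]; rewrite geq_max => /andP[df1 df2].
  by rewrite (IH1 nf1 df1) (IH2 nf2 df2).
- exact: HE.
Qed.

Lemma decides_refine d C : decides d C -> decides d.+1 (refine C).
Proof.
move=> dC m m' marksE u v E; apply: sat_equiv_exists (E) _ => h nf dh.
have marksC i : color C (m := m) (tnth (marks m) i) =
                color C (m := m') (tnth (marks m') i) by case: (marksE i).
split; apply: sat_exists_transfer nf dh => //.
  exact: dC marksC.
by apply: dC => i.
Qed.

(** All unmarked vertices share the empty set as colour, so the constant rank 0 suffices. *)
Definition mark_coloring : coloring.
Proof.
refine (@Coloring {set 'I_k} mark_set id (fun=> 0) _ _) => //.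
by move=> m u v /eqP-> /eqP->; left.
Defined.

Lemma coloring_decides d : exists C, decides d C.
Proof.
elim: d => [|d [C dC]]; last by exists (refine C); apply: decides_refine.
(* Depth 0 admits no path quantifier. *)
by exists mark_coloring => m m' _ u v E; apply: sat_equiv_exists E _.
Qed.

End MarkedTopology.

(** * Finiteness of the set of classes *)

Lemma finite_set_quotient (T U : Type) (X : finType) (F : T -> X) (c : T -> U) :
  (forall t t', F t = F t' -> c t = c t') ->
  finite_set [set y | exists t, y = c t]%classic.
Proof.
move=> Fc; have [[t0]|noT] := pselect (inhabited T); last first.
  rewrite (_ : [set y | exists t, y = c t]%classic = classical_sets.set0) //.
  by rewrite -subset0 => y [t _]; apply: noT; exists.
(* [g] picks a preimage of each attained value, with [t0] for the others; the image of [c \o g] then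
   contains every class. *)
have [g gP] : exists g : X -> T, forall t, F (g (F t)) = F t.
  have /choice[g gP] (a : X) : exists t, forall t', F t' = a -> F t = a.
    have [[t ta]|no] := pselect (exists t, F t = a); first by exists t.
    by exists t0 => t' ta; case: no; exists t'.
  by exists g => t; apply: gP.
apply: (@sub_finite_set _ _ ((c \o g) @` setT)%classic).
  by move=> y [t ->]; exists (F t) => //=; apply: Fc.
by apply: finite_image; apply: finite_finset.
Qed.

Local Open Scope classical_set_scope.

Theorem theorem7 (k d : nat) (hk : 0 < k) (hd : 0 < d) :
  finite_set [set C : set (marked_topology k) |
    exists m : marked_topology k, C = ctlsx_class d m].
Proof.
have [C dC] := coloring_decides k d.
(* The colours of the marks feed the premise of [decides]; the root is where formulas are
   evaluated. *)
pose F (m : marked_topology k) :=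
  ([ffun i : 'I_k => color C (m := m) (tnth (marks m) i)],
   color C (m := m) (root_vertex (graph m))).
apply: (@finite_set_quotient _ _ _ F) => m m' [/ffunP marksE rootE].
have E : ctlsx_equiv d (marked_lts m) (marked_lts m').
  by apply: dC rootE => i; have := marksE i; rewrite !ffunE.
by apply/seteqP; split=> m'' E' f nf df; have := E f nf df;
  have := E' f nf df; tauto.
Qed.
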